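(* If $G$ is a graph of order $n\geq 5$ that has no $2$-degenerate cut, then the size (number of edges) of $G$ is at least $\frac{27n-35}{10}$.
   Context: All graphs are finite, simple, and undirected. The order of a graph is its number of vertices and its size is its number of edges. A graph $H$ is $2$-degenerate if every non-empty subgraph $H'$ of $H$ has a vertex $u$ of degree $d_{H'}(u)$ at most $2$. A set $S$ of vertices of a graph $G$ is a cut of $G$ if $G-S$ is disconnected (has at least two connected components). A $2$-degenerate cut of $G$ is a cut $S$ of $G$ such that the induced subgraph $G[S]$ is $2$-degenerate. *)

(* Defs.v *)
From mathcomp Require Import all_boot all_order all_algebra.
Set Implicit Arguments.
Unset Strict Implicit.
Unset Printing Implicit Defensive.

Record sgraph := SGraph {
  vertex :> finType;
  adj : rel vertex;
  adj_sym : symmetric adj;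
  adj_irrefl : irreflexive adj }.

Definition order_graph (G : sgraph) : nat := #|G|.

Definition edges (G : sgraph) : {set {set G}} :=
  [set [set x; y] | x in G, y in G & adj x y].

Definition size_graph (G : sgraph) : nat := #|edges G|.

Section Induced.
Variables (G : sgraph) (S : {set G}).

Definition induced_adj : rel {x : G | x \in S} := relpre val (@adj G).

Lemma induced_adj_sym : symmetric induced_adj.
Proof. by move=> x y; apply: adj_sym. Qed.

Lemma induced_adj_irrefl : irreflexive induced_adj.
Proof. by move=> x; apply: adj_irrefl. Qed.

Definition induced : sgraph := SGraph induced_adj_sym induced_adj_irrefl.
End Induced.

(* A subgraph, not necessarily induced, of [G] is a vertex set [W] with a
   symmetric adjacency relation [f] contained in that of [G] and supported
   on [W]; irreflexivity of [f] is inherited from [G]. *)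
Definition is_subgraph (G : sgraph) (W : {set G}) (f : rel G) : Prop :=
  symmetric f /\ forall x y, f x y -> [/\ x \in W, y \in W & adj x y].

Definition two_degenerate (H : sgraph) : Prop :=
  forall (W : {set H}) (f : rel H), is_subgraph W f -> W != set0 ->
  exists2 u, u \in W & #|[set v | f u v]| <= 2.

(* [n_comp] counts connected components because [adj] is symmetric. *)
Definition disconnected (G : sgraph) : Prop := 2 <= n_comp (@adj G) G.

Definition is_cut (G : sgraph) (S : {set G}) : Prop :=
  disconnected (induced (~: S)).

Definition two_degenerate_cut (G : sgraph) (S : {set G}) : Prop :=
  is_cut S /\ two_degenerate (induced S).

(* Main.v *)
(** Induction on the order.  If the neighbourhood [N] of a vertex [x] is almost a
    clique, delete [x] and complete [N] to a clique: a 2-degenerate cut of the new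
    graph would be one of [G], because the vertices of the clique that lie outside
    the cut stay together.  Degrees below 4 do not occur, and this settles
    vertices of degree 4 and every vertex of degree 5 whose neighbourhood spans at least 8 edges.  In the remaining
    graphs the minimum degree is at least 5, and the neighbourhood of a vertex of
    degree 5 is a [K_4] plus a vertex with at most one neighbour in it.  The
    neighbourhood of two adjacent vertices of degree 5 would then be too sparse to
    contain a subgraph of minimum degree 3, unless the second one is that extra
    vertex.  Hence a vertex of degree 5 has at most one neighbour of degree 5, and
    moving a charge of 1/10 along each edge from degree at least 6 to degree 5
    gives average degree at least 27/5. *)
Require Import Defs.
From mathcomp Require Import all_boot all_order all_algebra.
From mathcomp Require Import zify lra.

Set Implicit Arguments.
Unset Strict Implicit.
Unset Printing Implicit Defensive.

(** * Degrees and cores relative to a vertex set *)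

Section Sets.
Variable T : finType.
Implicit Types (e : rel T) (A B N S W : {set T}) (x y : T).

(** The ground type stays fixed throughout: deleting a vertex shrinks [A], adding edges changes
    [e]. *)
Definition nbr e A x := [set y in A | e x y].

Definition degree_sum e A := \sum_(x in A) #|nbr e A x|.

Definition core e W := (W != set0) && [forall u in W, 3 <= #|nbr e W u|].

(* A set is 2-degenerate iff it contains no [core]; [B] is a union of components
   of [A :\: S]. *)
Definition no_degenerate_cut e A := forall B S : {set T},
  B != set0 -> B \subset A -> S \subset A -> [disjoint B & S] ->
  (forall x y, x \in B -> y \in A -> e x y -> y \in B :|: S) ->
  ~~ (A \subset B :|: S) -> exists2 W : {set T}, W \subset S & core e W.

Lemma nbr_subset e A x : nbr e A x \subset A.
Proof. by apply/subsetP => y; rewrite inE => /andP[]. Qed.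

Lemma coreP e W :
  reflect (W != set0 /\ forall u, u \in W -> 3 <= #|nbr e W u|) (core e W).
Proof.
by apply: (iffP andP) => -[W0 h]; split=> //; [move/forall_inP: h | apply/forall_inP].
Qed.

Lemma card_nbr_lt e A x : irreflexive e -> x \in A -> #|nbr e A x| < #|A|.
Proof.
move=> eI xA; apply: proper_card; apply/properP; split; first exact: nbr_subset.
by exists x; rewrite // inE eI andbF.
Qed.

Lemma core_card e W : irreflexive e -> core e W -> 4 <= #|W|.
Proof.
move=> eI /coreP[/set0Pn[x xW] h].
exact: leq_ltn_trans (h x xW) (card_nbr_lt eI xW).
Qed.

Lemma degree_sumD1 e A x : symmetric e -> irreflexive e -> x \in A ->
  degree_sum e A = degree_sum e (A :\ x) + #|nbr e A x|.*2.
Proof.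
move=> eS eI xA; rewrite /degree_sum (big_setD1 x xA) /=.
have -> : \sum_(y in A :\ x) #|nbr e A y| =
          \sum_(y in A :\ x) (#|nbr e (A :\ x) y| + e x y).
  apply: eq_bigr => y _; rewrite (cardsD1 x (nbr e A y)) inE xA eS addnC.
  by congr (#|pred_of_set _| + _); apply/setP => z; rewrite !inE andbA.
rewrite big_split /= addnCA -addnn; congr (_ + (_ + _)).
rewrite -sum1dep_card big_mkcond /= [RHS]big_mkcond /=.
apply: eq_bigr => y _; rewrite !inE.
by case: eqP => [->|_]; rewrite ?eI ?andbF //=; case: (y \in A); case: (e x y).
Qed.

Lemma degree_sum_even e A : symmetric e -> irreflexive e -> ~~ odd (degree_sum e A).
Proof.
move=> eS eI; have [n] := ubnP #|A|; elim: n A => // n IH A ltAn.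
have [-> | [x xA]] := set_0Vmem A; first by rewrite /degree_sum big_set0.
rewrite (degree_sumD1 eS eI xA) oddD odd_double addbF; apply: IH.
by move: ltAn; rewrite (cardsD1 x) xA.
Qed.

Lemma degree_sum_ge e A k : (forall x, x \in A -> k <= #|nbr e A x|) ->
  #|A| * k <= degree_sum e A.
Proof. by move=> h; rewrite -sum_nat_const; apply: leq_sum. Qed.

Lemma degree_sum_core e A : core e A -> #|A| * 3 <= degree_sum e A.
Proof. by case/coreP=> _; apply: degree_sum_ge. Qed.

(** * Deleting a vertex and completing its neighbourhood *)

Definition add_clique e N : rel T :=
  fun u v => e u v || [&& u != v, u \in N & v \in N].

Lemma add_clique_sym e N : symmetric e -> symmetric (add_clique e N).
Proof.
by move=> eS u v; rewrite /add_clique eS eq_sym [(u \in N) && _]andbC.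
Qed.

Lemma add_clique_irrefl e N : irreflexive e -> irreflexive (add_clique e N).
Proof. by move=> eI u; rewrite /add_clique eI eqxx. Qed.

Lemma core_add_clique e N W : core e W -> core (add_clique e N) W.
Proof.
move=> /coreP[W0 h]; apply/coreP; split=> // u uW; apply: leq_trans (h u uW) _.
apply/subset_leq_card/subsetP => v; rewrite !inE /add_clique => /andP[-> ->] //.
Qed.

Lemma no_degenerate_cut_add_clique e A x : symmetric e -> x \in A ->
  no_degenerate_cut e A -> no_degenerate_cut (add_clique e (nbr e A x)) (A :\ x).
Proof.
move=> eS xA nc B S B0 sB sS dBS clos ncov; set N := nbr e A x in clos *.
have xB : x \notin B by apply/negP => /(subsetP sB); rewrite !inE eqxx.
have xS : x \notin S by apply/negP => /(subsetP sS); rewrite !inE eqxx.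
have sBA : B \subset A := subset_trans sB (subsetDl _ _).
have sSA : S \subset A := subset_trans sS (subsetDl _ _).
have closB u v : u \in B -> v \in A -> e u v -> v != x -> v \in B :|: S.
  by move=> uB vA uv vx; apply: (clos u) => //; rewrite ?inE ?vx // /add_clique uv.
have [W sW cW] : exists2 W : {set T}, W \subset S & core e W; last first.
  by exists W => //; apply: core_add_clique.
have [w wA wBS] : exists2 w, w \in A :\ x & w \notin B :|: S by apply/subsetPn.
(* If [B] meets [N], then [x] joins [B]: the clique edges at [b] put all other neighbours of [x]
   into [B :|: S]. Otherwise no edge leads from [B] to [x], and [B] is already closed. *)
have [/existsP[b /andP[bB bN]] | Nno] := boolP [exists b, (b \in B) && (b \in N)].
- apply: (nc (x |: B) S) => //.
  + by apply/set0Pn; exists x; rewrite setU11.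
  + by rewrite subUset sub1set xA.
  + by rewrite disjoints_subset subUset sub1set inE xS -disjoints_subset.
  + move=> u v; rewrite !inE => /predU1P[-> | uB] vA uv; last first.
      by case: (eqVneq v x) => //= vx; have := closB u v uB vA uv vx; rewrite inE.
    case: (eqVneq v x) => //= vx; case: (eqVneq v b) => [-> | vb]; first by rewrite bB.
    have := clos b v bB; rewrite !inE vx vA; apply=> //.
    by rewrite /add_clique eq_sym vb bN /N inE vA uv orbT.
  + apply/subsetPn; exists w; first by case/setD1P: wA.
    by move: wA wBS; rewrite !inE => /andP[/negbTE->].
- apply: (nc B S) => //.
  + move=> u v uB vA uv; case: (eqVneq v x) => [vx | ]; last exact: (closB u v).
    case/existsP: Nno; exists u; rewrite uB inE (subsetP sBA) //=.
    by rewrite eS -vx.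
  + by apply/subsetPn; exists w => //; case/setD1P: wA.
Qed.

(** A vertex [u] of [N] gets the neighbours [nbr e A u :|: (N :\ u)], and these two sets already
    share [nbr e N u]; vertices outside [N] keep theirs. *)
Lemma degree_sum_add_clique e A N : irreflexive e -> N \subset A ->
  degree_sum (add_clique e N) A + degree_sum e N <=
  degree_sum e A + #|N| * #|N|.-1.
Proof.
move=> eI sNA; rewrite /degree_sum.
rewrite (big_setID N) /= [X in _ <= X + _](big_setID N) /= (setIidPr sNA).
rewrite -!addnA [X in _ + X]addnC [X in _ <= _ + X]addnC !addnA.
apply: leq_add; last first.
  apply: leq_sum => u; rewrite !inE => /andP[uN _].
  apply/subset_leq_card/subsetP => v.
  by rewrite !inE /add_clique (negbTE uN) andbF orbF.
rewrite -sum_nat_const -!big_split /=; apply: leq_sum => u uN.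
have -> : nbr (add_clique e N) A u = nbr e A u :|: (N :\ u).
  apply/setP => v; rewrite !inE /add_clique uN /= [u == v]eq_sym.
  by case: (boolP (v \in N)) => [/(subsetP sNA)-> | _]; rewrite ?andbT ?andbF ?orbF.
have <- : #|N :\ u| = #|N|.-1 by rewrite [in RHS](cardsD1 u) uN.
rewrite -[leqRHS]cardsUI leq_add2l; apply/subset_leq_card/subsetP => v.
rewrite !inE => /andP[vN uv]; rewrite vN uv (subsetP sNA) //= andbT.
by apply: contraTneq uv => ->; rewrite eI.
Qed.

(* The factor is 5 rather than 10 because [degree_sum] counts every edge twice. *)
Definition size_bound e A := 27 * #|A| <= 5 * degree_sum e A + 35.

(** The numerical hypothesis says that deleting the edges at [x] and adding the missing pairs of [N]
    loses at least 27/10 edges on balance. *)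
Lemma size_bound_add_clique e A x (N := nbr e A x) :
  symmetric e -> irreflexive e -> x \in A ->
  27 + 5 * (#|N| * #|N|.-1) <= 10 * #|N| + 5 * degree_sum e N ->
  size_bound (add_clique e N) (A :\ x) -> size_bound e A.
Proof.
rewrite /size_bound => eS eI xA; rewrite (degree_sumD1 eS eI xA) (cardsD1 x A) xA.
have sN : N \subset A :\ x.
  apply/subsetP => v; rewrite !inE => /andP[-> xv]; rewrite andbT.
  by apply: contraTneq xv => ->; rewrite eI.
have := @degree_sum_add_clique e (A :\ x) N eI sN.
by rewrite -/N; lia.
Qed.

(** * Cores inside neighbourhoods *)

(** The neighbourhood separates [x] from the remaining vertices, of which the cardinality hypothesis
    leaves at least one. *)
Lemma core_in_nbr e A x : irreflexive e -> no_degenerate_cut e A -> x \in A ->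
  #|nbr e A x| + 1 < #|A| -> exists2 W : {set T}, W \subset nbr e A x & core e W.
Proof.
move=> eI nc xA lt; apply: (nc [set x] (nbr e A x)).
- by apply/set0Pn; exists x; rewrite set11.
- by rewrite sub1set.
- exact: nbr_subset.
- by rewrite disjoints1 inE eI andbF.
- by move=> u v /set1P-> vA uv; rewrite !inE vA uv orbT.
- apply: contraL lt => /subset_leq_card h; rewrite -leqNgt.
  by apply: leq_trans h _; rewrite cardsU1 addnC leq_add2l leq_b1.
Qed.

(** A core in [N] has 5 or 4 vertices. If 5, the degree sum is at least 15 and even; if 4, it is at
    least 12 plus twice the degree of the vertex left out. *)
Lemma sparse_vertex_or_dense_nbr e A x (N := nbr e A x) :
  symmetric e -> irreflexive e -> no_degenerate_cut e A -> x \in A ->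
  6 < #|A| -> #|N| = 5 ->
  16 <= degree_sum e N \/
  exists y, [/\ y \in N, #|nbr e N y| <= 1 & core e (N :\ y)].
Proof.
move=> eS eI nc xA A6 N5.
have [|W sW cW] := core_in_nbr eI nc xA; first by rewrite -/N N5; lia.
have W4 := core_card eI cW.
have [eWN | neWN] := eqVneq W N.
  left; have := degree_sum_core cW; have := degree_sum_even W eS eI.
  rewrite eWN N5 => even D15; rewrite ltn_neqAle D15 andbT.
  by apply: contraNneq even => <-.
have [y yN yW] : exists2 y, y \in N & y \notin W.
  by apply/subsetPn; apply: contraNN neWN => sNW; rewrite eqEsubset sW.
have eW : W = N :\ y.
  apply/eqP; rewrite eqEcard; apply/andP; split.
    by rewrite subsetD1 sW.
  by move: N5; rewrite (cardsD1 y) yN; lia.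
have [h | h] := leqP (#|nbr e N y|) 1; first by right; exists y; rewrite -eW.
left; have := degree_sum_core cW; rewrite (degree_sumD1 eS eI yN) -eW.
by lia.
Qed.

(** A non-neighbour [v] would leave [u] only two possible neighbours in [W]. *)
Lemma core4_adj e W u v : irreflexive e -> core e W -> #|W| = 4 ->
  u \in W -> v \in W -> u != v -> e u v.
Proof.
move=> eI /coreP[_ h] W4 uW vW uv; apply: contraT => euv.
have : nbr e W u \subset W :\ u :\ v.
  apply/subsetP => w; rewrite !inE => /andP[-> uw]; rewrite andbT.
  by apply/andP; split; apply: contraTneq uw => ->; rewrite ?eI.
move/subset_leq_card; have := h u uW.
move: W4; rewrite (cardsD1 u) uW (cardsD1 v (W :\ u)) !inE eq_sym uv vW /=.
by lia.
Qed.

(** The vertices other than [x] and [a] that are adjacent to one of them form a cut without a core: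
    [y] and [z] lie in no core, and at most three further vertices remain. *)
Lemma adj_degree5 e A x y a (N := nbr e A x) (M := nbr e A a) z :
  symmetric e -> irreflexive e -> no_degenerate_cut e A -> 7 < #|A| ->
  x \in A -> #|N| = 5 -> y \in N -> #|nbr e N y| <= 1 -> core e (N :\ y) ->
  a \in N :\ y -> #|M| = 5 -> z \in M -> #|nbr e M z| <= 1 -> core e (M :\ z) ->
  False.
Proof.
move=> eS eI nc A7 xA N5 yN dy cK aK M5 zM dz cL.
set K := N :\ y in aK cK; set L := M :\ z in cL.
have K4 : #|K| = 4 by move: N5; rewrite (cardsD1 y) yN => -[].
have Ka3 : #|K :\ a| = 3 by move: K4; rewrite (cardsD1 a) aK => -[].
have L4 : #|L| = 4 by move: M5; rewrite (cardsD1 z) zM => -[].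
have aN : a \in N by case/setD1P: aK.
have [aA xa] : a \in A /\ e x a by move: aN; rewrite inE => /andP[].
have sKaM : x |: K :\ a \subset M.
  apply/subsetP => b /setU1P[-> | /setD1P[ba bK]]; first by rewrite inE xA eS.
  rewrite inE (core4_adj eI cK K4 aK bK) 1?eq_sym // andbT.
  by move: bK; rewrite !inE => /andP[_ /andP[]].
have xK : x \notin K by rewrite !inE eI !andbF.
have xKa4 : #|x |: K :\ a| = 4.
  by rewrite cardsU1 inE (negbTE xK) andbF Ka3.
have xKadj u v : u \in x |: K -> v \in x |: K -> u != v -> e u v.
  have xb b : b \in K -> e x b by rewrite !inE => /and3P[].
  move=> /setU1P[-> | uK] /setU1P[-> | vK] //; rewrite ?eqxx //; first by move=> _; apply: xb.
    by move=> _; rewrite eS; apply: xb.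
  exact: core4_adj cK K4 uK vK.
(* [x |: K :\ a] is a [K_4] inside [M], so the sparse vertex [z] lies outside it; hence it is all of
   [L]. *)
have zxKa : z \notin x |: K :\ a.
  apply: contraL dz => zK; rewrite -ltnNge.
  have /subset_leq_card : (x |: K :\ a) :\ z \subset nbr e M z.
    apply/subsetP => v /setD1P[vz vK]; rewrite inE (subsetP sKaM) //=.
    have sub w : w \in x |: K :\ a -> w \in x |: K.
      by rewrite !inE => /orP[-> //|/andP[_ ->]]; rewrite orbT.
    by apply: xKadj; rewrite 1?eq_sym //; apply: sub.
  have -> : #|(x |: K :\ a) :\ z| = 3 by move: xKa4; rewrite (cardsD1 z) zK => -[].
  exact: ltnW.
have eL : x |: K :\ a = L.
  by apply/eqP; rewrite eqEcard L4 xKa4 subsetD1 sKaM zxKa.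
set B := [set x; a]; set S := (N :|: M) :\: B.
have sSN : S \subset z |: N.
  apply/subsetP => v /setDP[/setUP[vN _ | vM vB]]; first by rewrite inE vN orbT.
  rewrite !in_setU1; case: (eqVneq v z) => //= vz.
  have : v \in L by rewrite !in_setD1 vz.
  rewrite -eL => /setU1P[vx | /setD1P[_ /setD1P[]] //].
  by rewrite vx !inE eqxx in vB.
have sSM : S \subset y |: M.
  apply/subsetP => v /setDP[/setUP[vN vB | vM _]]; last by rewrite inE vM orbT.
  rewrite !in_setU1; case: (eqVneq v y) => //= vy; apply: (subsetP sKaM).
  move: vB; rewrite /B !in_set2 in_setU1 !in_setD1 vy vN !negb_or andbT.
  by move=> /andP[_ ->]; rewrite orbT.
have sSK : S :\ y :\ z \subset K :\ a.
  apply/subsetP => v /setD1P[vz /setD1P[vy vS]].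
  have := subsetP sSN v vS; rewrite in_setU1 (negbTE vz) /= => vN.
  by move: vS; rewrite /S /B /K in_setD in_set2 negb_or !in_setD1 vy vN => /andP[/andP[_ ->]].
(* All of [S] except possibly [w] lies in [P], so [u] has at most 1 + 1 neighbours in [S]. *)
have sub_nbr w u P : S \subset w |: P -> #|nbr e P u| <= 1 ->
    forall W : {set T}, W \subset S -> core e W -> u \notin W.
  move=> sSP du W sWS /coreP[_ h]; apply/negP => /h.
  have /subset_leq_card : nbr e W u \subset w |: nbr e P u.
    apply/subsetP => v; rewrite inE => /andP[/(subsetP sWS)/(subsetP sSP)].
    by rewrite !inE => /orP[-> // | -> ->]; rewrite orbT.
  rewrite cardsU1 => le2 ge3.
  by have := leq_trans ge3 (leq_trans le2 (leq_add (leq_b1 _) du)).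
have sSA : S \subset A.
  by rewrite subDset subUset !(subset_trans (nbr_subset _ _ _)) ?subsetUr.
have [||||||W sWS cW] := nc B S.
- by apply/set0Pn; exists x; rewrite !inE eqxx.
- by rewrite subUset !sub1set xA.
- exact: sSA.
- by rewrite disjoint_sym disjoints_subset /S setDE subsetIr.
- move=> u v /set2P[] -> vA uv;
    rewrite /S /N /M in_setU in_setD in_setU ![_ \in nbr _ _ _]inE vA uv /=;
    by rewrite ?orbT andbT orbN.
(* [B :|: S] has at most 2 + 3 + 2 = 7 vertices. *)
- apply: contraL A7 => /subset_leq_card h; rewrite -leqNgt.
  have hB : #|B| <= 2 by rewrite cards2; case: (x != a).
  have hU : #|B :|: S| <= #|B| + #|S| by rewrite cardsU leq_subr.
  have hS : #|S| <= #|K :\ a| + 2.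
    have := subset_leq_card sSK; rewrite (cardsD1 y S) (cardsD1 z (S :\ y)).
    move=> le; rewrite addnA addnC.
    exact: leq_add le (leq_add (leq_b1 _) (leq_b1 _)).
  by rewrite Ka3 in hS; apply: leq_trans h (leq_trans hU (leq_add hB hS)).
have yW := sub_nbr _ _ _ sSN dy W sWS cW.
have zW := sub_nbr _ _ _ sSM dz W sWS cW.
have sWK : W \subset K :\ a by apply: subset_trans sSK; rewrite !subsetD1 sWS yW zW.
by have := leq_trans (core_card eI cW) (subset_leq_card sWK); rewrite Ka3.
Qed.

(** * Discharging *)

Lemma degree_sum_discharge e A : symmetric e ->
  (forall x, x \in A -> 5 <= #|nbr e A x|) ->
  (forall x, x \in A -> #|nbr e A x| = 5 ->
     4 <= #|[set y in nbr e A x | #|nbr e A y| != 5]|) ->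
  27 * #|A| <= 5 * degree_sum e A.
Proof.
move=> eS d5 h; pose P := [set x in A | #|nbr e A x| == 5].
have PA : P \subset A by apply/subsetP => x; rewrite inE => /andP[].
have QE x : (x \in A :\: P) = (x \in A) && (#|nbr e A x| != 5).
  by rewrite !inE; case: (x \in A); rewrite ?andbF ?andbT.
have cA : #|A| = #|P| + #|A :\: P| by rewrite -(cardsID P A) (setIidPr PA).
have DA : degree_sum e A = #|P| * 5 + \sum_(x in A :\: P) #|nbr e A x|.
  rewrite /degree_sum (big_setID P) /= (setIidPr PA); congr (_ + _).
  by rewrite -sum_nat_const; apply: eq_bigr => x; rewrite inE => /andP[_ /eqP].
have D6 : #|A :\: P| * 6 <= \sum_(x in A :\: P) #|nbr e A x|.
  rewrite -sum_nat_const; apply: leq_sum => x; rewrite QE => /andP[xA x5].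
  by rewrite ltn_neqAle eq_sym x5 d5.
(* Both sides are compared with the number of edges between [P] and [A :\: P]. *)
have D4 : #|P| * 4 <= \sum_(x in A :\: P) #|nbr e A x|.
  apply: (@leq_trans (\sum_(x in P) \sum_(y in A :\: P) e x y)).
    rewrite -sum_nat_const; apply: leq_sum => x; rewrite inE => /andP[xA /eqP x5].
    apply: leq_trans (h x xA x5) _.
    rewrite -sum1dep_card big_mkcond [leqRHS]big_mkcond /=; apply: leq_sum => y _.
    by rewrite QE inE; case: (y \in A) => //=; case: (e x y); case: (_ != 5).
  rewrite exchange_big /=; apply: leq_sum => y _.
  rewrite -sum1dep_card big_mkcond [leqRHS]big_mkcond /=; apply: leq_sum => x _.
  by rewrite inE eS; case: (x \in A) => //=; case: (e y x); case: (_ == 5).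
(* With [s] the degree sum over [A :\: P], the claim is [2 * #|P| + 27 * #|A :\: P| <= 5 * s]: half
   of [D4] plus 9/2 times [D6]. *)
by lia.
Qed.

(** * Induction on the order *)

Lemma no_degenerate_cut_size_bound e A : symmetric e -> irreflexive e -> 5 <= #|A| ->
  no_degenerate_cut e A -> size_bound e A.
Proof.
(* The relation is generalized as well, since the reduction adds edges. *)
move: {2}#|A| (erefl #|A|) => n; elim: n => [|n IH] in e A *; first by move=> ->.
move=> An eS eI A5 nc.
have red x : x \in A -> 5 < #|A| ->
    27 + 5 * (#|nbr e A x| * #|nbr e A x|.-1) <=
      10 * #|nbr e A x| + 5 * degree_sum e (nbr e A x) -> size_bound e A.
  move=> xA A6 hx; apply: (size_bound_add_clique eS eI xA hx).
  have An1 : #|A :\ x| = n by move: An; rewrite (cardsD1 x) xA => -[].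
  apply: IH => //; [exact: add_clique_sym | exact: add_clique_irrefl | by lia |].
  exact: no_degenerate_cut_add_clique.
have d4 x : x \in A -> 4 <= #|nbr e A x|.
  move=> xA; rewrite leqNgt; apply/negP => d3.
  have [|W sW /(core_card eI)] := core_in_nbr eI nc xA; first by lia.
  by have := subset_leq_card sW; lia.
(* Order 5 is the base case, with equality for [K_5]: 27 * 5 = 5 * 20 + 35. *)
have [A6 | A6] := leqP #|A| 5.
  by rewrite /size_bound; have := degree_sum_ge d4; lia.
have [/exists_inP[x xA /eqP dx] | nd4] := boolP [exists x in A, #|nbr e A x| == 4].
  have [|W sW cW] := core_in_nbr eI nc xA; first by lia.
  have eW : W = nbr e A x by apply/eqP; rewrite eqEcard sW dx (core_card eI cW).
  apply: (red x xA A6); have := degree_sum_core cW; rewrite eW dx; lia.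
have d5 x : x \in A -> 5 <= #|nbr e A x|.
  move=> xA; rewrite ltn_neqAle d4 // andbT eq_sym.
  by apply: contra nd4 => hx; apply/exists_inP; exists x.
(* Minimum degree 5 suffices for [#|A| <= 17], so no neighbourhood considered
   below is dominating. *)
have [A7 | A7] := leqP #|A| 7.
  by rewrite /size_bound; have := degree_sum_ge d5; lia.
have [/exists_inP[x xA /andP[/eqP dx hx]] | sparse] :=
  boolP [exists x in A, (#|nbr e A x| == 5) && (16 <= degree_sum e (nbr e A x))].
  by apply: (red x xA A6); rewrite dx; lia.
have sp x : x \in A -> #|nbr e A x| = 5 ->
    exists y, [/\ y \in nbr e A x, #|nbr e (nbr e A x) y| <= 1 & core e (nbr e A x :\ y)].
  move=> xA dx; have [||//] := sparse_vertex_or_dense_nbr eS eI nc xA _ dx; first by lia.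
  by move=> hx; case/exists_inP: sparse; exists x; rewrite // dx eqxx.
rewrite /size_bound; apply: leq_trans (leq_addr _ _).
apply: degree_sum_discharge => // x xA dx.
have [y [yN dy cK]] := sp x xA dx.
have K4 : #|nbr e A x :\ y| = 4 by move: dx; rewrite (cardsD1 y) yN => -[].
(* The four required neighbours are the vertices of the [K_4]; only [y] may have degree 5. *)
rewrite -[leqLHS]K4; apply/subset_leq_card/subsetP => a aK; rewrite inE.
have aN : a \in nbr e A x by case/setD1P: aK.
rewrite aN; apply/eqP => da.
have [|z [zM dz cL]] := sp a _ da; first exact: (subsetP (nbr_subset e A x)).
exact: (@adj_degree5 e A x y a z).
Qed.

End Sets.

(** * From relations on sets back to graphs *)

(** Incidences are counted in two ways: neighbours of [x] inject into the edges at [x], and an edge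
    has at most two ends. *)
Lemma degree_sum_le_edges (G : sgraph) :
  degree_sum (@adj G) [set: G] <= 2 * #|edges G|.
Proof.
apply: (@leq_trans (\sum_(x in [set: G]) \sum_(E in edges G) (x \in E))).
  apply: leq_sum => x _.
  have inj : {in nbr (@adj G) [set: G] x &, injective (fun y => [set x; y])}.
    move=> y z; rewrite !inE /= => xy xz /setP/(_ y); rewrite !inE eqxx orbT.
    by case: (eqVneq y x) => [yx | _ /esym/eqP //]; rewrite yx adj_irrefl in xy.
  rewrite -(card_in_imset inj) -big_mkcondr sum1dep_card.
  apply/subset_leq_card/subsetP => E /imsetP[y]; rewrite !inE /= => xy ->.
  rewrite !inE eqxx andbT; apply/imset2P; exists x y => //.
  by rewrite inE.
rewrite exchange_big /= mulnC -sum_nat_const; apply: leq_sum => E.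
case/imset2P=> x y _ _ ->; rewrite -big_mkcondr sum1dep_card.
apply: (@leq_trans #|[set x; y]|); last by rewrite cards2; case: (x != y).
by apply/subset_leq_card/subsetP => z; rewrite !inE.
Qed.

(** Since [f] is contained in [adj], a vertex with at most two neighbours in the image of [W] also
    has at most two under [f]. *)
Lemma two_degenerate_no_core (G : sgraph) (S : {set G}) :
  (forall W : {set G}, W \subset S -> ~~ core (@adj G) W) ->
  two_degenerate (induced S).
Proof.
move=> h W f [_ sf] W0.
have sWS : [set val w | w in W] \subset S.
  by apply/subsetP => _ /imsetP[w _ ->]; apply: (valP w).
have := h _ sWS; rewrite /core imset_eq0 W0 /= => /forall_inPn[_ /imsetP[u uW ->]].
rewrite -ltnNge ltnS => du; exists u => //; apply: leq_trans du.
rewrite -(card_imset _ (@val_inj _ _ _)); apply/subset_leq_card/subsetP.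
move=> _ /imsetP[v /[!inE] /sf[_ vW uv] ->]; rewrite imset_f //=.
Qed.

Lemma is_cut_closed (G : sgraph) (B S : {set G}) (b c : G) :
  b \in B -> b \notin S -> c \notin B :|: S ->
  (forall x y, x \in B -> adj x y -> y \in B :|: S) -> is_cut S.
Proof.
move=> bB bS cBS clos; move: (cBS); rewrite inE negb_or => /andP[cB cS].
rewrite /is_cut /disconnected; set H := induced _.
have bP : b \in ~: S by rewrite inE.
have cP : c \in ~: S by rewrite inE.
pose b' : H := exist _ b bP; pose c' : H := exist _ c cP.
have sym : connect_sym (@adj H) by apply: sym_connect_sym; apply: adj_sym.
have clB : closed (@adj H) [pred x : H | val x \in B].
  apply: intro_closed => // x y xy xB.
  have := clos _ _ xB xy; rewrite inE => /orP[//|yS].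
  by have := valP y; rewrite inE yS.
(* With a single component, [b] and [c] would share a root, although [B] is closed under adjacency
   outside [S]. *)
rewrite ltnNge; apply/negP => /card_le1_eqP inj.
have : fingraph.root (@adj H) b' = fingraph.root (@adj H) c'.
  by apply: inj; rewrite inE /= inE andbT; apply: roots_root.
move/eqP; rewrite (root_connect sym) => /(closed_connect clB).
by rewrite !inE /= bB (negbTE cB).
Qed.

Lemma no_two_degenerate_cut (G : sgraph) :
  ~ (exists S : {set G}, two_degenerate_cut S) ->
  no_degenerate_cut (@adj G) [set: G].
Proof.
move=> hcut B S /set0Pn[b bB] _ _ dBS clos /subsetPn[c _ cBS].
(* Containing a core is decidable, so the core can be obtained by contradiction with [hcut]. *)
have [/exists_inP[W sW cW] | nW] := boolP [exists W in powerset S, core (@adj G) W].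
  by exists W => //; rewrite powersetE in sW.
case: hcut; exists S; split; last first.
  apply: two_degenerate_no_core => W sW; apply: contra nW => cW.
  by apply/exists_inP; exists W; rewrite ?powersetE.
apply: (is_cut_closed bB (negbT (disjointFr dBS bB)) cBS) => x y xB.
by apply: clos.
Qed.

Theorem theorem2 (G : sgraph) (n : nat) (hn : 5 <= n) (hG : order_graph G = n)
  (hcut : ~ exists S : {set G}, two_degenerate_cut S) :
  ((27 * n%:R - 35) / 10 <= (size_graph G)%:R :> rat)%R.
Proof.
have cardG : #|[set: G]| = n by rewrite cardsT.
have bound : size_bound (@adj G) [set: G].
  apply: no_degenerate_cut_size_bound (no_two_degenerate_cut hcut).
  - exact: adj_sym.
  - exact: adj_irrefl.
  - by rewrite cardG.
have : 27 * n <= 10 * size_graph G + 35.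
  by move: bound (degree_sum_le_edges G); rewrite /size_bound /size_graph cardG; lia.
by rewrite -(Num.Theory.ler_nat rat) GRing.natrD !GRing.natrM; lra.
Qed.
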